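(* Let $\mathfrak{B}$ be a real Banach space and $X\subset\mathfrak{B}$ compact. Then $$\tau^*(X)\le d_B(X-X)\le 2d_B(X),$$ where $X-X=\{x-y:x,y\in X\}$.
   Context: Box-counting dimension: for $Y\subset\mathfrak{B}$, $d_B(Y)=\limsup_{\epsilon\to0}\frac{\log N(Y,\epsilon)}{-\log\epsilon}$, where $N(Y,\epsilon)$ is the minimum number of balls of radius $\epsilon$ with centres in $Y$ required to cover $Y$. Dual thickness exponent: for $X\subset\mathfrak{B}$ and $\epsilon,\theta>0$, let $d_\theta(X,\epsilon)$ be the minimum dimension of all those linear subspaces $U$ of the dual $\mathfrak{B}^*$ with the property that for every $x,y\in X$ with $\|x-y\|\ge\epsilon$ there exists $\phi\in U$ with $\|\phi\|=1$ and $|\phi(x-y)|\ge\epsilon^{1+\theta}$ (with $d_\theta(X,\epsilon)=\infty$ if no such finite-dimensional subspace exists). For $\theta>0$ put $\tau^*_\theta(X)=\limsup_{\epsilon\to0}\frac{\log d_\theta(X,\epsilon)}{-\log\epsilon}$, and set $\tau^*(X)=\lim_{\theta\to0}\tau^*_\theta(X)$. *)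

(* Defs.v *)
From HB Require Import structures.
From mathcomp Require Import all_boot all_order all_algebra.
From mathcomp Require Import all_classical all_reals all_analysis.

Set Implicit Arguments.
Unset Strict Implicit.
Unset Printing Implicit Defensive.

Import Order.TTheory GRing.Theory Num.Theory.
Import numFieldNormedType.Exports.

Local Open Scope classical_set_scope.
Local Open Scope ring_scope.

Definition diff_set (V : zmodType) (X : set V) : set V :=
  [set x - y | x in X & y in X].

(* The least element of a set of natural numbers, as an extended real;
   it is +oo when the set is empty. *)
Definition min_nat (R : realType) (A : set nat) : \bar R :=
  ereal_inf [set n%:R%:E | n in A].

(* limsup_{eps -> 0+} log (N eps) / (- log eps), with log 0 = -oo and
   log +oo = +oo (the conventions of [lne]). *)
Definition growth_exponent (R : realType) (N : R -> \bar R) : \bar R :=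
  limf_esup (fun eps : R => (lne (N eps) / (- ln eps)%:E)%E) 0^'+.

Section BoxDimension.
Context {R : realType} {B : normedModType R}.
Implicit Types Y : set B.

Definition covered_by_balls Y (eps : R) (n : nat) : Prop :=
  exists c : 'I_n -> B,
    (forall i, Y (c i)) /\ Y `<=` \bigcup_i ball (c i) eps.

Definition covering_number Y (eps : R) : \bar R :=
  min_nat R [set n | covered_by_balls Y eps n].

Definition box_dim Y : \bar R := growth_exponent (covering_number Y).

End BoxDimension.

(* U is a linear subspace of V of finite dimension n, i.e. it has a basis with
   n elements. *)
Definition subspace_of_dim (R : realType) (V : lmodType R) (U : set V)
    (n : nat) : Prop :=
  exists e : 'I_n -> V,
    (forall c : 'I_n -> R, \sum_i c i *: e i = 0 -> forall i, c i = 0) /\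
    U = range (fun c : 'I_n -> R => \sum_i c i *: e i).

Section DualThickness.
Context {R : realType} {B : normedModType R}.
Implicit Types (X : set B) (U : set (B -> R^o)).

(* The dual is a set of functions into R^o rather than R so that its linear
   structure is the one of the pointwise lmodType B -> R^o. *)
Definition dual_space : set (B -> R^o) :=
  [set phi | linear phi /\ continuous phi].

(* A genuine supremum only for bounded functionals, i.e. on dual_space. *)
Definition dual_norm (phi : B -> R^o) : R :=
  sup [set `|phi x| | x in [set x : B | `|x| <= 1]].

Definition separates (theta : R) X (eps : R) U : Prop :=
  forall x y, X x -> X y -> eps <= `|x - y| ->
    exists phi, [/\ U phi, dual_norm phi = 1 &
                    eps `^ (1 + theta) <= `|phi (x - y)|].

Definition dual_dim (theta : R) X (eps : R) : \bar R :=
  min_nat R [set n | exists U, [/\ U `<=` dual_space,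
                                   subspace_of_dim U n &
                                   separates theta X eps U]].

Definition dual_thickness_at (theta : R) X : \bar R :=
  growth_exponent (dual_dim theta X).

(* dual_thickness_at theta X is nonincreasing in theta, so this limit always
   exists in \bar R. *)
Definition dual_thickness X : \bar R :=
  lim (dual_thickness_at theta X @[theta --> 0^'+]).

End DualThickness.

(* Main.v *)
(* Cover [X - X] by N balls of radius [e / 3] centred at z_1, ..., z_N, and let
   U be the span of functionals norming the nonzero z_i.  If [e <= |x - y|] and
   [x - y] lies in the ball around z_i, the functional norming z_i is at least
   [|z_i| - e / 3 >= e / 3 >= e^(1 + theta)] at [x - y] once e is small, so the
   dual dimension at scale e is at most the covering number at scale [e / 3].
   Differences of the centres of a cover of X by n balls of radius [e / 2]
   centre a cover of [X - X] by [n ^ 2] balls of radius e.  The factors 1/3 and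
   1/2 disappear in the limsup.

   Norming functionals are obtained from Zorn's lemma: a minimal sublinear
   functional is linear, and the norm lowered along z is a sublinear functional
   whose value at - z is at most [- |z|]. *)
Require Import Defs.
From HB Require Import structures.
From mathcomp Require Import all_boot all_order all_algebra.
From mathcomp Require Import all_classical all_reals all_analysis.
From mathcomp Require Import lra ring.

Set Implicit Arguments.
Unset Strict Implicit.
Unset Printing Implicit Defensive.

Import Order.TTheory GRing.Theory Num.Theory.
Import numFieldNormedType.Exports.

Local Open Scope classical_set_scope.
Local Open Scope ring_scope.

(* Only [<=] is required in the homogeneity clause; equality follows for
   positive scalars. *)
Definition sublinear (R : realType) (V : lmodType R) (p : V -> R) : Prop :=
  (forall x y, p (x + y) <= p x + p y) /\
  (forall a x, 0 <= a -> p (a *: x) <= a * p x).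

Lemma le_scale_inf (R : realType) (S : set R) (a c : R) :
  S !=set0 -> 0 <= a -> (forall s, S s -> c <= a * s) -> c <= a * inf S.
Proof.
move=> S0; rewrite le_eqVlt => /predU1P[<-|a0] h.
  by case: S0 => s /h; rewrite !mul0r.
rewrite mulrC -ler_pdivrMr//; apply: lb_le_inf => // s /h.
by rewrite ler_pdivrMr// mulrC.
Qed.

(** * Hahn-Banach through minimal sublinear functionals *)

Section Sublinear.
Context {R : realType} {V : lmodType R}.
Implicit Types (p q : V -> R) (x y z : V).

Lemma sublinear0 p : sublinear p -> p 0 = 0.
Proof.
move=> [pD pZ]; apply/eqP; rewrite eq_le; apply/andP; split.
  by have := pZ 0 0 (lexx _); rewrite scale0r mul0r.
by have := pD 0 0; rewrite addr0 -{1}[p 0]addr0 lerD2l.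
Qed.

Lemma sublinearZ p a x : sublinear p -> 0 <= a -> p (a *: x) = a * p x.
Proof.
move=> sp; rewrite le_eqVlt => /predU1P[<-|a0].
  by rewrite scale0r mul0r sublinear0.
apply/eqP; rewrite eq_le; apply/andP; split; first exact: sp.2 (ltW a0).
rewrite mulrC -ler_pdivlMr// mulrC.
have := sp.2 a^-1 (a *: x).
by rewrite scalerA mulVf ?gt_eqF// scale1r invr_ge0 ltW//; exact.
Qed.

Lemma sublinear_ge_opp p x : sublinear p -> - p (- x) <= p x.
Proof.
move=> sp; have := sp.1 x (- x); rewrite subrr sublinear0//.
by rewrite -subr_ge0 subr0 => h; rewrite -subr_ge0 opprK.
Qed.

Lemma sublinear_linear p : sublinear p -> (forall x, p (- x) = - p x) ->
  linear (p : V -> R^o).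
Proof.
move=> sp pN; have pD := sp.1.
have pDE x y : p (x + y) = p x + p y.
  apply/eqP; rewrite eq_le pD/= -lerBrDr.
  by have := pD (x + y) (- y); rewrite addrK pN.
move=> a x y; rewrite pDE; congr (_ + _); case: (leP 0 a) => [a0|a0].
  exact: sublinearZ.
rewrite -[a]opprK scaleNr pN sublinearZ ?oppr_ge0 1?ltW//.
by rewrite [RHS]scaleNr.
Qed.

(* The largest sublinear minorant of [q] whose value at [- z] is at most
   [- q z]. *)
Definition lower_along z q x : R :=
  inf [set q (x + t *: z) - t * q z | t in [set t | 0 <= t]].

Lemma lower_along_has_lbound z q x : sublinear q ->
  has_lbound [set q (x + t *: z) - t * q z | t in [set t | 0 <= t]].
Proof.
(* Subadditivity at [t *: z = - x + (x + t *: z)] gives this bound. *)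
move=> sq; exists (- q (- x)) => _ [t /= t0 <-].
have := sq.1 (- x) (x + t *: z); rewrite addKr sublinearZ//; lra.
Qed.

Lemma lower_along_le z q x t : sublinear q -> 0 <= t ->
  lower_along z q x <= q (x + t *: z) - t * q z.
Proof.
by move=> sq t0; apply: ge_inf; [exact: lower_along_has_lbound|exists t].
Qed.

Lemma lower_along_sublinear z q : sublinear q -> sublinear (lower_along z q).
Proof.
move=> sq; have [qD qZ] := sq.
have ne x : [set q (x + t *: z) - t * q z | t in [set t | 0 <= t]] !=set0.
  by exists (q (x + 0 *: z) - 0 * q z); exists 0; first exact: lexx.
split=> [x y|a x a0]; last first.
  apply: (le_scale_inf (ne x)) => // _ [t /= t0 <-].
  apply: le_trans (lower_along_le z (a *: x) sq (mulr_ge0 a0 t0)) _.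
  by rewrite -scalerA -scalerDr mulrBr -mulrA lerD2r qZ.
(* Parameters [s] for [x] and [t] for [y] combine into [s + t] for [x + y]. *)
rewrite -lerBlDr; apply: lb_le_inf => // _ [s /= s0 <-].
rewrite lerBlDl -lerBlDr; apply: lb_le_inf => // _ [t /= t0 <-].
rewrite lerBlDl; apply: le_trans (lower_along_le _ _ sq (addr_ge0 s0 t0)) _.
have := qD (x + s *: z) (y + t *: z); rewrite addrACA -scalerDl.
by move=> h; rewrite mulrDl; lra.
Qed.

(** Zorn's lemma applies because the pointwise infimum of a chain is again sublinear: two members
    are comparable, so the smaller one serves at both [x] and [y]. *)
Lemma minimal_sublinear p : sublinear p ->
  exists q, [/\ sublinear q, forall x, q x <= p x &
    forall r, sublinear r -> (forall x, r x <= q x) -> forall x, q x <= r x].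
Proof.
move=> sp.
pose P q := sublinear q /\ forall x, q x <= p x; pose T := {q | P q}.
(* The order is reversed, so that a maximal element is a minimal functional. *)
pose ord (s t : T) := `[< forall x, sval t x <= sval s x >].
pose t1 : T := exist P p (conj sp (fun=> lexx _)).
have [||A totA|q qmin] := @ZL_preorder T t1 ord.
- by move=> t; apply/asboolP.
- move=> r s t /asboolP rs /asboolP st; apply/asboolP => x.
  exact: le_trans (st x) (rs x).
- have [->|/set0P[t0 At0]] := eqVneq A set0; first by exists t1.
  pose S x := [set sval t x | t in A].
  have lbS x : has_lbound (S x).
    exists (- p (- x)) => _ [[q [sq qp]] _ <-] /=.
    by apply: le_trans (sublinear_ge_opp _ sq); rewrite lerN2.
  have neS x : S x !=set0 by exists (sval t0 x), t0.
  have infS x t : A t -> inf (S x) <= sval t x.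
    by move=> At; apply: ge_inf => //; exists t.
  have sq : sublinear (fun x => inf (S x)).
    split=> [x y|a x a0]; last first.
      apply: le_scale_inf => // _ [t At <-]; apply: le_trans (infS _ _ At) _.
      exact: (svalP t).1.2.
    rewrite -lerBlDr; apply: lb_le_inf => // _ [s As <-].
    rewrite lerBlDl -lerBlDr; apply: lb_le_inf => // _ [t At <-].
    rewrite lerBlDl.
    have [/asboolP st|/asboolP ts] := totA _ _ As At.
      apply: le_trans (infS _ _ At) _; apply: le_trans ((svalP t).1.1 _ _) _.
      by rewrite lerD2r.
    apply: le_trans (infS _ _ As) _; apply: le_trans ((svalP s).1.1 _ _) _.
    by rewrite lerD2l.
  have qp x : inf (S x) <= p x.
    by apply: le_trans (infS x _ At0) _; exact: (svalP t0).2.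
  by exists (exist P _ (conj sq qp)) => t At; apply/asboolP => x; exact: infS.
- case: q qmin => q [sq qp] qmin; exists q; split=> // r sr rq.
  have rp x : r x <= p x := le_trans (rq x) (qp x).
  have /asboolP// := qmin (exist P r (conj sr rp)) (asboolT rq).
Qed.

(** Lowering a minimal [q] along [x] cannot change it, and parameter 1 at [- x] then yields
    [q (- x) <= - q x]; the reverse inequality is subadditivity. An odd sublinear functional is
    linear. *)
Lemma linear_below_sublinear p : sublinear p ->
  exists2 f : V -> R^o, linear f & forall x, f x <= p x.
Proof.
move=> /minimal_sublinear[q [sq qp qmin]]; exists q => //.
apply: sublinear_linear => // x; apply/eqP; rewrite eq_le; apply/andP; split.
  apply: le_trans (qmin _ (lower_along_sublinear x sq) _ (- x)) _ => [y|].
    have := lower_along_le x y sq (lexx 0).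
    by rewrite scale0r addr0 mul0r subr0.
  have := lower_along_le x (- x) sq ler01.
  by rewrite scale1r addNr mul1r sublinear0// sub0r.
by have := sublinear_ge_opp x sq; lra.
Qed.

End Sublinear.

(** * Norming functionals *)

Section NormingFunctional.
Context {R : realType} {B : normedModType R}.

Lemma norm_sublinear : sublinear (fun x : B => `|x|).
Proof.
by split=> [x y|a x a0]; [exact: ler_normD|rewrite normrZ (ger0_norm a0)].
Qed.

Lemma norming_functional (z : B) : z != 0 ->
  exists phi : B -> R^o, [/\ dual_space phi, dual_norm phi = 1,
    forall x, `|phi x| <= `|x| & phi z = `|z|].
Proof.
move=> z0; have sn := norm_sublinear.
(* Parameter 0 gives [f x <= |x|]; parameter 1 at [- z] gives [f (- z) <= - |z|]. *)
have [f lf fle] := linear_below_sublinear (lower_along_sublinear z sn).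
have f0 : f 0 = 0 by have := lf (-1) 0 0; rewrite scaler0 addr0 scaleN1r addNr.
have fD x y : f (x + y) = f x + f y by rewrite -[x in LHS]scale1r lf scale1r.
have fN x : f (- x) = - f x.
  by apply/eqP; rewrite -addr_eq0 -fD addNr f0.
have fZ a x : f (a *: x) = a * f x by rewrite -[a *: x]addr0 lf f0 addr0.
have fn x : f x <= `|x|.
  have := le_trans (fle x) (lower_along_le z x sn (lexx 0)).
  by rewrite scale0r addr0 mul0r subr0.
have fa x : `|f x| <= `|x|.
  by rewrite ler_norml fn andbT lerNl -fN -[leRHS]normrN fn.
have fz : f z = `|z|.
  apply/eqP; rewrite eq_le fn/=.
  have := le_trans (fle (- z)) (lower_along_le z (- z) sn ler01).
  by rewrite scale1r addNr normr0 mul1r sub0r fN lerN2.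
exists f; split => //.
  split=> // x; apply/cvgrPdist_lt => /= e e0; near=> y.
  rewrite -fN -fD; apply: le_lt_trans (fa _) _; near: y.
  exact: (@cvgr_dist_lt _ _ _ _ (nbhs_filter x) id).
have ub1 : ubound [set `|f x| | x in [set x : B | `|x| <= 1]] 1.
  by move=> _ [x /= x1 <-]; exact: le_trans (fa x) x1.
apply/eqP; rewrite eq_le; apply/andP; split.
  apply: ge_sup => //; exists `|f 0|; exists 0 => //=.
  by rewrite normr0.
apply: ub_le_sup; first by exists 1.
have nz : `|z| != 0 by rewrite normr_eq0.
exists (`|z|^-1 *: z); last by rewrite fZ fz mulVf// normr1.
by rewrite /= normrZ normfV normr_id mulVf.
Unshelve. all: by end_near. Qed.

End NormingFunctional.

(** * Spans and bases *)

Section LinearCombinations.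
Context {R : realType} {V : lmodType R}.
Implicit Types (W : set V) (n : nat).

Lemma lincomb_closed W n (f : 'I_n -> V) (c : 'I_n -> R) :
  W 0 -> (forall a x y, W x -> W y -> W (a *: x + y)) -> (forall i, W (f i)) ->
  W (\sum_i c i *: f i).
Proof.
move=> W0 WD Wf; apply: (big_ind W) => // [x y Wx Wy|i _].
  by rewrite -[x]scale1r; exact: WD.
by rewrite -[_ *: _]addr0; exact: WD.
Qed.

(** [subspace_of_dim] asks for a basis, whereas norming functionals may be dependent. In a dependent
    family, a member with nonzero coefficient is dropped without shrinking the span. *)
Lemma linear_basis_of_family n (e : 'I_n -> V) :
  exists m (f : 'I_m -> V), [/\ (m <= n)%N, range f `<=` range e,
    forall c : 'I_m -> R, \sum_i c i *: f i = 0 -> forall i, c i = 0 &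
    range e `<=` range (fun c : 'I_m -> R => \sum_i c i *: f i)].
Proof.
elim: n e => [|n IH] e.
  by exists 0%N, e; split=> // [c _ []//|_ [[]//]].
have [ind|] := pselect (forall c, \sum_i c i *: e i = 0 -> forall i, c i = 0).
  exists n.+1, e; split=> // _ [i _ <-]; exists (fun j => (j == i)%:R) => //=.
  rewrite (bigD1 i)//= eqxx scale1r big1 ?addr0// => j /negPf ->.
  by rewrite scale0r.
move=> /existsNP[c /not_implyP[c0 /existsNP[i0 /eqP ci0]]].
have [m [f [mn fe ind ef]]] := IH (e \o lift i0).
pose W := range (fun c : 'I_m -> R => \sum_i c i *: f i).
have W0 : W 0 by exists (fun=> 0) => //; rewrite big1// => i _; rewrite scale0r.
have WD a x y : W x -> W y -> W (a *: x + y).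
  move=> [u _ <-] [v _ <-]; exists (fun i => a * u i + v i) => //.
  rewrite scaler_sumr -big_split/=; apply: eq_bigr => i _.
  by rewrite scalerDl scalerA.
have We i : W (e (lift i0 i)) by apply: ef; exists i.
exists m, f; split=> //; first exact: leqW.
  by move=> _ [i _ <-]; have [j _ <-] := fe _ (imageT f i); exists (lift i0 j).
move=> _ [i _ <-]; case: (unliftP i0 i) => [j ->|->]; first exact: We.
suff -> : e i0 = - (c i0)^-1 *: \sum_i c (lift i0 i) *: e (lift i0 i) + 0.
  by apply: (WD _ _ _ _ W0); exact: (lincomb_closed _ W0 WD We).
move: c0; rewrite (bigD1_ord i0)//= addr0 => /eqP; rewrite addrC addr_eq0.
by move=> /eqP ->; rewrite scaleNr scalerN opprK scalerA mulVf// scale1r.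
Qed.

End LinearCombinations.

Lemma dual_space0 (R : realType) (B : normedModType R) :
  dual_space (0 : B -> R^o).
Proof.
split=> [a x y|]; first by rewrite /= scaler0 addr0.
exact: cst_continuous.
Qed.

Lemma dual_space_linear (R : realType) (B : normedModType R)
    (a : R) (f g : B -> R^o) :
  dual_space f -> dual_space g -> dual_space (a *: f + g).
Proof.
move=> [lf cf] [lg cg]; split=> [b x y|x].
  rewrite !fctE/= lf lg !scalerDr !scalerA (mulrC a b); lra.
by apply: cvgD (cg x); apply: cvgZl_tmp; exact: cf.
Qed.

(** * Growth exponents and minima of sets of naturals *)

Section Growth.
Context {R : realType}.
Implicit Types (M N : R -> \bar R) (A : set nat).

Lemma near0_right (P : R -> Prop) : (\forall e \near 0^'+, P e) ->
  exists2 d, 0 < d & forall e, 0 < e < d -> P e.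
Proof.
move=> [d /= d0 h]; exists d => // e /andP[e0 ed]; apply: h => //=.
by rewrite sub0r normrN gtr0_norm.
Qed.

(** With [growth_exponent_le], this trades the limsup for an eventual inequality; the quotient is
    cleared using [0 < - ln e] for [e < 1]. *)
Lemma growth_exponent_lt N (r : R) : (growth_exponent N < r%:E)%E ->
  \forall e \near 0^'+, (lne (N e) <= (r * - ln e)%:E)%E.
Proof.
move=> /ereal_inf_lt[_ [A A0 <-] Ar]; near=> e.
have e0 : 0 < e by near: e; exact: nbhs_right_gt.
have e1 : e < 1 by near: e; exact: nbhs_right_lt.
have Ae : A e by near: e.
have l0 : 0 < - ln e by rewrite oppr_gt0 ln_lt0// e0.
have := le_trans (ereal_sup_ubound (imageP _ Ae)) (ltW Ar).
by rewrite inver gt_eqF// lee_pdivrMr// EFinM.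
Unshelve. all: by end_near. Qed.

Lemma growth_exponent_le N (r : R) :
  (\forall e \near 0^'+, (lne (N e) <= (r * - ln e)%:E)%E) ->
  (growth_exponent N <= r%:E)%E.
Proof.
move=> /near0_right[d d0 h]; apply: ge_ereal_inf.
pose A := [set e | 0 < e < Num.min d 1].
exists (ereal_sup ((fun e => lne (N e) / (- ln e)%:E)%E @` A)).
  exists A => //; near=> e; apply/andP; split; near: e.
    exact: nbhs_right_gt.
  by apply: nbhs_right_lt; rewrite lt_min d0 ltr01.
apply: ge_ereal_sup => _ [e /= /andP[e0 +] <-]; rewrite lt_min => /andP[ed e1].
have l0 : 0 < - ln e by rewrite oppr_gt0 ln_lt0// e0.
by rewrite inver gt_eqF// lee_pdivrMr// -EFinM h// e0.
Unshelve. all: by end_near. Qed.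

(* Rescaling the argument is harmless since [ln (c * e) / ln e --> 1]. *)
Lemma growth_exponent_scale M N (c k : R) : 0 < c -> 0 < k ->
  (\forall e \near 0^'+, (lne (M e) <= k%:E * lne (N (c * e)%R))%E) ->
  (growth_exponent M <= k%:E * growth_exponent N)%E.
Proof.
move=> c0 k0 MN.
have step r : (growth_exponent N < r%:E)%E ->
    (growth_exponent M <= (k * r)%:E)%E.
  move=> /growth_exponent_lt/near0_right[d d0 hN].
  apply/lee_addgt0Pr => del del0; rewrite -EFinD; apply: growth_exponent_le.
  near=> e.
  have e0 : 0 < e by near: e; exact: nbhs_right_gt.
  have ed : c * e < d.
    rewrite mulrC -ltr_pdivlMr//; near: e; apply: nbhs_right_lt.
    exact: divr_gt0.
  (* Rescaling adds [- (k * r * ln c)] to the bound; below this threshold the excess is at most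
     [del * - ln e]. *)
  have ee : e < expR (k * r * ln c / del).
    by near: e; apply: nbhs_right_lt; exact: expR_gt0.
  have le_e : ln e < k * r * ln c / del by rewrite -ltr_expR lnK.
  have : (lne (M e) <= k%:E * lne (N (c * e)%R))%E by near: e.
  move=> /le_trans; apply.
  apply: (@le_trans _ _ (k%:E * (r * - ln (c * e)%R)%:E)%E).
    by apply: lee_wpmul2l; rewrite ?lee_fin ?(ltW k0)// hN// mulr_gt0.
  rewrite -EFinM lee_fin lnM ?posrE//.
  by move: le_e; rewrite ltr_pdivlMr//; lra.
case E : (growth_exponent N) => [g| |].
- apply/lee_addgt0Pr => del del0.
  have -> : (k%:E * g%:E + del%:E = (k * (g + del / k))%:E)%E.
    by rewrite -EFinM -EFinD; congr EFin; field; rewrite gt_eqF.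
  by apply: step; rewrite E lte_fin ltrDl divr_gt0.
- by rewrite gt0_muley ?lte_fin// leey.
- rewrite gt0_muleNy ?lte_fin// leeNy_eq; apply/eqP/eq_ninfty => A.
  have := step (A / k); rewrite E ltNyr => /(_ isT).
  by rewrite mulrC divfK ?gt_eqF.
Unshelve. all: by end_near. Qed.

Lemma min_nat_ge0 A : (0 <= min_nat R A)%E.
Proof. by apply: le_ereal_inf_tmp => _ [n _ <-]; rewrite lee_fin. Qed.

Lemma min_nat_le A n : A n -> (min_nat R A <= n%:R%:E)%E.
Proof. by move=> An; apply: ereal_inf_lbound; exists n. Qed.

Lemma min_natP A :
  min_nat R A = +oo%E \/ exists2 n, A n & min_nat R A = n%:R%:E.
Proof.
have [->|/set0P[n0 An0]] := eqVneq A set0.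
  by left; rewrite /min_nat image_set0 ereal_inf0.
right; have exA : exists n, `[< A n >] by exists n0; exact/asboolP.
case: (ex_minnP exA) => n /asboolP An nmin; exists n => //.
apply/eqP; rewrite eq_le min_nat_le//=.
apply: le_ereal_inf_tmp => _ [m Am <-]; rewrite lee_fin ler_nat.
by apply: nmin; exact/asboolP.
Qed.

Lemma le_min_nat A (A' : set nat) : A `<=` A' ->
  (min_nat R A' <= min_nat R A)%E.
Proof. by move=> AA'; apply: ereal_inf_le_tmp; exact: image_subset. Qed.

Lemma le_lne_ge0 (x y : \bar R) : (0 <= x)%E -> (x <= y)%E ->
  (lne x <= lne y)%E.
Proof.
move=> x0 xy; rewrite lee_lne// in_itv/= leey andbT//.
exact: le_trans xy.
Qed.

End Growth.

(** * Comparison of covering numbers and dual dimensions *)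

Section Covering.
Context {R : realType} {B : normedModType R}.
Implicit Types X : set B.

Lemma covering_number_diff X (e : R) :
  (lne (covering_number (diff_set X) e) <=
   2%:E * lne (covering_number X (2^-1 * e)%R))%E.
Proof.
rewrite /covering_number.
have [->|[n [c [Xc cov]] ->]] :=
  @min_natP R [set n | covered_by_balls X (2^-1 * e) n].
  by rewrite gt0_muley ?leey.
have : (min_nat R [set n | covered_by_balls (diff_set X) e n] <=
    (n%:R ^+ 2)%:E)%E.
  rewrite -natrX; apply: min_nat_le.
  have En : #|{: 'I_n * 'I_n}| = (n ^ 2)%N by rewrite card_prod card_ord mulnn.
  pose p (i : 'I_(n ^ 2)) : 'I_n * 'I_n := enum_val (cast_ord (esym En) i).
  exists (fun i => c (p i).1 - c (p i).2); split=> [i|_ [x Xx [y Xy <-]]].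
    by exists (c (p i).1) => //; exists (c (p i).2).
  have [i _ ix] := cov _ Xx; have [j _ jy] := cov _ Xy.
  exists (cast_ord En (enum_rank (i, j))) => //.
  rewrite /p cast_ordK enum_rankK/=.
  move: ix jy; rewrite -!ball_normE/= => ix jy.
  have -> : c i - c j - (x - y) = (c i - x) - (c j - y).
    by rewrite !opprB addrACA [RHS]addrACA [- c j - x]addrC.
  apply: le_lt_trans (ler_normB _ _) _; lra.
move=> /(le_lne_ge0 (min_nat_ge0 _))/le_trans; apply.
(* An empty cover is treated apart: its logarithm is [-oo]. *)
case: n {c Xc cov} => [|n]; first by rewrite expr0n le0_lneNy ?leNye.
by rewrite !lne_EFin ?exprn_gt0// -EFinM lee_fin lnXn// mulr_natl.
Qed.

Lemma dual_dim_le_covering_number (theta : R) X (e : R) :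
  0 < e -> e `^ theta <= 3^-1 ->
  (dual_dim theta X e <= covering_number (diff_set X) (3^-1 * e)%R)%E.
Proof.
move=> e0 eth; rewrite /covering_number.
have [->|[n [z [_ cov]] ->]] :=
  @min_natP R [set n | covered_by_balls (diff_set X) (3^-1 * e) n].
  by rewrite leey.
have [phi hphi] : {phi : 'I_n -> B -> R^o & forall i,
    dual_space (phi i) /\ (z i != 0 -> [/\ dual_norm (phi i) = 1,
      forall x, `|phi i x| <= `|x| & phi i (z i) = `|z i|])}.
  apply: (@choice _ _ (fun i (f : B -> R^o) => dual_space f /\ (z i != 0 ->
    [/\ dual_norm f = 1, forall x, `|f x| <= `|x| & f (z i) = `|z i|]))) => i.
  (* A zero centre has no norming functional and gets 0; its ball contains no difference of norm at
     least [e]. *)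
  have [z0|z0] := eqVneq (z i) 0.
    by exists 0; split=> //; exact: dual_space0.
  by have [f [? ? ? ?]] := norming_functional z0; exists f.
have [m [f [mn fphi find phif]]] := linear_basis_of_family phi.
apply: (@le_trans _ _ m%:R%:E); last by rewrite lee_fin ler_nat.
apply: min_nat_le; exists (range (fun c : 'I_m -> R => \sum_i c i *: f i)).
split.
- move=> _ [c _ <-]; apply: lincomb_closed.
  + exact: dual_space0.
  + by move=> *; exact: dual_space_linear.
  + by move=> i; have [j _ <-] := fphi _ (imageT f i); have [] := hphi j.
- by exists f.
move=> x y Xx Xy exy.
have [i _] : (\bigcup_i ball (z i) (3^-1 * e)) (x - y).
  by apply: cov; exists x => //; exists y.
rewrite -ball_normE/= => zi.
have zle : e - 3^-1 * e < `|z i|.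
  have := ler_normB (z i) (z i - (x - y)); rewrite subKr; lra.
have zi0 : z i != 0 by rewrite -normr_gt0; lra.
have [[lphi _] /(_ zi0)[p1 ple pz]] := hphi i.
exists (phi i); split=> //; first by apply: phif; exists i.
have pB u v : phi i (u - v) = phi i u - phi i v.
  by rewrite addrC -scaleN1r lphi scaleN1r addrC.
have h1 : e `^ (1 + theta) <= 3^-1 * e.
  rewrite powRD ?(gt_eqF e0) ?implybT// powRr1 ?(ltW e0)//.
  by rewrite mulrC ler_pM2r.
apply: (le_trans h1).
(* [phi i (x - y)] is at least [|z i| - |z i - (x - y)|], which exceeds [2 e / 3 - e / 3]. *)
have := ple (z i - (x - y)); rewrite pB pz.
have := ler_norm (`|z i| - phi i (x - y)).
have := ler_norm (phi i (x - y)).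
lra.
Qed.

Lemma dual_thickness_at_le theta X : 0 < theta ->
  (dual_thickness_at theta X <= box_dim (diff_set X))%E.
Proof.
move=> th0; rewrite -[leRHS]mul1e.
apply: (@growth_exponent_scale _ _ _ 3^-1) => //.
near=> e; rewrite mul1e; apply: le_lne_ge0; first exact: min_nat_ge0.
have e0 : 0 < e by near: e; exact: nbhs_right_gt.
apply: dual_dim_le_covering_number => //.
(* This threshold solves [e^theta = 1/3]. *)
have : e <= 3^-1 `^ theta^-1.
  by near: e; apply: nbhs_right_le; rewrite powR_gt0.
move=> h; have := ge0_ler_powR (ltW th0) _ _ h.
rewrite !nnegrE powR_ge0 (ltW e0) => /(_ isT isT).
by rewrite -powRrM mulVf ?gt_eqF// powRr1.
Unshelve. all: by end_near. Qed.

(** For [e <= 1] a larger [theta] lowers the threshold [e^(1 + theta)], so the same subspace still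
    separates. *)
Lemma dual_thickness_at_nonincreasing X :
  {homo (fun theta => dual_thickness_at theta X) :
    s t / s <= t >-> (t <= s)%E}.
Proof.
move=> s t st; rewrite -[leRHS]mul1e.
apply: (@growth_exponent_scale _ _ _ 1) => //.
near=> e; rewrite mul1e mul1r; apply: le_lne_ge0; first exact: min_nat_ge0.
have e0 : 0 < e by near: e; exact: nbhs_right_gt.
have e1 : e <= 1 by near: e; exact: nbhs_right_le.
apply: le_min_nat => n [U [Ud Un Us]]; exists U; split=> // x y Xx Xy exy.
have [phi [Up p1 pe]] := Us x y Xx Xy exy; exists phi; split=> //.
by apply: le_trans pe; rewrite ger_powR ?e0 ?lerD2l.
Unshelve. all: by end_near. Qed.

End Covering.

Theorem lemma4p4 (R : realType) (B : completeNormedModType R) (X : set B)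
    (cX : compact X) :
  (dual_thickness X <= box_dim (diff_set X))%E /\
  (box_dim (diff_set X) <= 2%:E * box_dim X)%E.
Proof.
split; last first.
  apply: (@growth_exponent_scale _ _ _ 2^-1) => //.
  by near=> e; exact: covering_number_diff.
(* By monotonicity the limit at [0^'+] is the supremum over [theta > 0], so a bound for each [theta]
   suffices. *)
have lim_sup := @nonincreasing_at_right_cvge R
  (fun theta => dual_thickness_at theta X) 0 +oo%O isT
  (fun s t _ _ st => dual_thickness_at_nonincreasing X st).
rewrite /dual_thickness (cvg_lim (@ereal_hausdorff R) lim_sup).
apply: ge_ereal_sup => _ [theta /= th0 <-].
by apply: dual_thickness_at_le; move: th0; rewrite in_itv/= andbT.
Unshelve. all: by end_near. Qed.
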